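(* Let $E$ be an arbitrary directed graph, $K$ a field and $L=L_K(E)$. A graded left ideal $S$ of $L$ is a minimal graded left ideal of $L$ if and only if $S=La$ where $a$ is a homogeneous element and $La\cong_{gr}Lu(n)$, where $u\in E^0$ is either a line point or a Laurent vertex and $n\in\mathbb{Z}$.
   Context: A directed graph $E=(E^0,E^1,r,s)$ has vertex set $E^0$, edge set $E^1$ and range/source maps $r,s$; no cardinality restriction is made. A path of length $n>0$ is a sequence of edges $\mu=e_1\cdots e_n$ with $r(e_i)=s(e_{i+1})$; vertices are paths of length $0$. A vertex is regular if it emits a nonempty finite set of edges. $L_K(E)$ is the (not necessarily unital) $K$-algebra generated by pairwise orthogonal idempotents $v\in E^0$ and elements $e,e^*$ ($e\in E^1$) subject to: $s(e)e=e=er(e)$; $r(e)e^*=e^*=e^*s(e)$; $e^*e=r(e)$ and $e^*f=0$ for $e\ne f$; $v=\sum_{s(e)=v}ee^*$ for each regular vertex $v$. It is $\mathbb{Z}$-graded by $\deg v=0$, $\deg e=1$, $\deg e^*=-1$. For a graded module $M$, the shift $M(k)$ has $M(k)_n=M_{k+n}$; $\cong_{gr}$ denotes a degree-preserving isomorphism (here of graded left $L$-modules). A minimal graded left ideal is a nonzero graded left ideal containing no graded left ideals other than $0$ and itself. A cycle is a closed path $e_1\cdots e_n$ ($n\geq1$, $r(e_n)=s(e_1)$) with $s(e_i)\ne s(e_j)$ for $i\neq j$. An exit of a path $e_1\cdots e_n$ is an edge $f$ with $s(f)=s(e_i)$, $f\ne e_i$ for some $i$. For a vertex $v$, $T_E(v)$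 is the set of vertices $w$ such that there is a path from $v$ to $w$. A bifurcation vertex is a vertex emitting more than one edge. A vertex $v$ is a line point if no vertex of $T_E(v)$ is a bifurcation vertex or the base of a cycle. A vertex $v$ is a Laurent vertex if $T_E(v)$ is the set of all vertices on a single path $\gamma=\mu c$, where $\mu$ is a path without bifurcations starting at $v$ and $c$ is a cycle without exits based at $r(\mu)$. *)

(* Defs.v *)
From HB Require Import structures.
From mathcomp Require Import all_boot all_order all_algebra finmap.
From mathcomp Require Import boolp classical_sets functions cardinality.

Set Implicit Arguments.
Unset Strict Implicit.
Unset Printing Implicit Defensive.

Import GRing.Theory.
Local Open Scope classical_set_scope.
Local Open Scope ring_scope.
Local Open Scope quotient_scope.

Record digraph := Digraph {
  vertex : Type;
  edge : Type;
  src : edge -> vertex;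
  rng : edge -> vertex }.

(* Arbitrary types, made into choiceTypes classically, so that [uniq],
   [fset_set] and so on are available without restricting the graph. *)
HB.instance Definition _ (E : digraph) := gen_eqMixin (vertex E).
HB.instance Definition _ (E : digraph) := gen_choiceMixin (vertex E).
HB.instance Definition _ (E : digraph) := gen_eqMixin (edge E).
HB.instance Definition _ (E : digraph) := gen_choiceMixin (edge E).

Section Graph.
Variable E : digraph.
Implicit Types (v w : vertex E) (e f : edge E) (p c m : seq (edge E)).

Definition out v : set (edge E) := [set e | src e = v].

Definition regular v := finite_set (out v) /\ out v !=set0.

(* [is_path v p w]: [p] is a path from [v] to [w]; the empty sequence stands
   for the path of length 0 at [v]. *)
Fixpoint is_path v p w : Prop :=
  if p is e :: p' then src e = v /\ is_path (rng e) p' w else v = w.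

Definition path_vertices v p : seq (vertex E) := v :: map (@rng E) p.

Definition tree v : set (vertex E) := [set w | exists p, is_path v p w].

Definition bifurcation v := exists e f, [/\ src e = v, src f = v & e <> f].

Definition cycle_at v c := [/\ c != [::], is_path v c v & uniq (map (@src E) c)].

Definition is_exit p f := exists e, [/\ e \in p, src f = src e & f <> e].

Definition line_point v := forall w, tree v w ->
  ~ bifurcation w /\ ~ (exists c, cycle_at w c).

Definition laurent_vertex v := exists m w c,
  [/\ is_path v m w,
      forall x, x \in path_vertices v m -> ~ bifurcation x,
      cycle_at w c,
      ~ (exists f, is_exit c f) &
      tree v = [set x | x \in path_vertices v (m ++ c)]].

End Graph.

(* Formal expressions in the generators of the Leavitt path algebra, to be
   divided by the least congruence that contains the axioms of (not necessarily
   unital) K-algebras and the defining relations. *)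
Inductive lpa_term (E : digraph) (K : fieldType) : Type :=
| TVtx of vertex E
| TEdge of edge E
| TGhost of edge E
| TZero
| TAdd of lpa_term E K & lpa_term E K
| TOpp of lpa_term E K
| TScale of K & lpa_term E K
| TMul of lpa_term E K & lpa_term E K.

Arguments TVtx {E K}.
Arguments TEdge {E K}.
Arguments TGhost {E K}.
Arguments TZero {E K}.

HB.instance Definition _ E K := gen_eqMixin (lpa_term E K).
HB.instance Definition _ E K := gen_choiceMixin (lpa_term E K).

Definition TSum E K (ts : seq (lpa_term E K)) := foldr (@TAdd E K) TZero ts.

Inductive lpa_rel (E : digraph) (K : fieldType) :
    lpa_term E K -> lpa_term E K -> Prop :=
| rel_refl s : lpa_rel s s
| rel_sym s t : lpa_rel s t -> lpa_rel t s
| rel_trans s t u : lpa_rel s t -> lpa_rel t u -> lpa_rel s u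
| rel_add s s' t t' :
    lpa_rel s s' -> lpa_rel t t' -> lpa_rel (TAdd s t) (TAdd s' t')
| rel_opp s s' : lpa_rel s s' -> lpa_rel (TOpp s) (TOpp s')
| rel_scale k s s' : lpa_rel s s' -> lpa_rel (TScale k s) (TScale k s')
| rel_mul s s' t t' :
    lpa_rel s s' -> lpa_rel t t' -> lpa_rel (TMul s t) (TMul s' t')
| rel_addA s t u : lpa_rel (TAdd s (TAdd t u)) (TAdd (TAdd s t) u)
| rel_addC s t : lpa_rel (TAdd s t) (TAdd t s)
| rel_add0 s : lpa_rel (TAdd TZero s) s
| rel_addN s : lpa_rel (TAdd (TOpp s) s) TZero
| rel_scaleA k l s : lpa_rel (TScale k (TScale l s)) (TScale (k * l) s)
| rel_scale1 s : lpa_rel (TScale 1 s) s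
| rel_scaleDr k s t :
    lpa_rel (TScale k (TAdd s t)) (TAdd (TScale k s) (TScale k t))
| rel_scaleDl k l s :
    lpa_rel (TScale (k + l) s) (TAdd (TScale k s) (TScale l s))
| rel_mulA s t u : lpa_rel (TMul s (TMul t u)) (TMul (TMul s t) u)
| rel_mulDl s t u : lpa_rel (TMul (TAdd s t) u) (TAdd (TMul s u) (TMul t u))
| rel_mulDr s t u : lpa_rel (TMul s (TAdd t u)) (TAdd (TMul s t) (TMul s u))
| rel_scaleAl k s t : lpa_rel (TScale k (TMul s t)) (TMul (TScale k s) t)
| rel_scaleAr k s t : lpa_rel (TScale k (TMul s t)) (TMul s (TScale k t))
| rel_vv v : lpa_rel (TMul (TVtx v) (TVtx v)) (TVtx v)
| rel_vw v w : v <> w -> lpa_rel (TMul (TVtx v) (TVtx w)) TZero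
| rel_se e : lpa_rel (TMul (TVtx (src e)) (TEdge e)) (TEdge e)
| rel_er e : lpa_rel (TMul (TEdge e) (TVtx (rng e))) (TEdge e)
| rel_rg e : lpa_rel (TMul (TVtx (rng e)) (TGhost e)) (TGhost e)
| rel_gs e : lpa_rel (TMul (TGhost e) (TVtx (src e))) (TGhost e)
| rel_ge e : lpa_rel (TMul (TGhost e) (TEdge e)) (TVtx (rng e))
| rel_gf e f : e <> f -> lpa_rel (TMul (TGhost e) (TEdge f)) TZero
| rel_ck v : regular v ->
    lpa_rel (TVtx v)
      (TSum [seq TMul (TEdge e) (TGhost e) | e <- fset_set (out v)]).

Section Algebra.
Variables (E : digraph) (K : fieldType).

Definition lpa_eqb (s t : lpa_term E K) : bool := `[< lpa_rel s t >].

Lemma lpa_eqb_refl : reflexive lpa_eqb.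
Proof. by move=> s; apply/asboolP/rel_refl. Qed.

Lemma lpa_eqb_sym : symmetric lpa_eqb.
Proof. by move=> s t; apply/asboolP/asboolP; apply: rel_sym. Qed.

Lemma lpa_eqb_trans : transitive lpa_eqb.
Proof.
move=> t s u /asboolP st /asboolP tu; apply/asboolP; exact: rel_trans st tu.
Qed.

Canonical lpa_equiv := EquivRel lpa_eqb lpa_eqb_refl lpa_eqb_sym lpa_eqb_trans.

Definition lpa := {eq_quot lpa_equiv}.

HB.instance Definition _ := Choice.on lpa.

Definition lpa_pi (t : lpa_term E K) : lpa := \pi t.

Lemma lpa_piP s t : lpa_pi s = lpa_pi t <-> lpa_rel s t.
Proof.
split=> [st|st]; first by apply/asboolP; apply/(@eqmodP _ lpa_equiv).
by apply/(@eqmodP _ lpa_equiv); apply/asboolP.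
Qed.

Lemma lpa_reprK (x : lpa) : lpa_pi (repr x) = x.
Proof. exact: reprK. Qed.

Lemma lpa_repr_pi t : lpa_rel (repr (lpa_pi t)) t.
Proof. by apply/lpa_piP; rewrite lpa_reprK. Qed.

Lemma lpa_ind (P : lpa -> Prop) : (forall t, P (lpa_pi t)) -> forall x, P x.
Proof. by move=> Ppi x; rewrite -[x]lpa_reprK. Qed.

Definition lpa_zero := lpa_pi TZero.
Definition lpa_add (x y : lpa) := lpa_pi (TAdd (repr x) (repr y)).
Definition lpa_opp (x : lpa) := lpa_pi (TOpp (repr x)).
Definition lpa_scale (k : K) (x : lpa) := lpa_pi (TScale k (repr x)).
Definition lpa_mul (x y : lpa) := lpa_pi (TMul (repr x) (repr y)).

Fact lpa_addE s t : lpa_add (lpa_pi s) (lpa_pi t) = lpa_pi (TAdd s t).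
Proof. by apply/lpa_piP/rel_add; apply: lpa_repr_pi. Qed.
Fact lpa_oppE s : lpa_opp (lpa_pi s) = lpa_pi (TOpp s).
Proof. by apply/lpa_piP/rel_opp/lpa_repr_pi. Qed.
Fact lpa_scaleE k s : lpa_scale k (lpa_pi s) = lpa_pi (TScale k s).
Proof. by apply/lpa_piP/rel_scale/lpa_repr_pi. Qed.

Fact lpa_addA : associative lpa_add.
Proof.
elim/lpa_ind=> s; elim/lpa_ind=> t; elim/lpa_ind=> u.
by rewrite !lpa_addE; apply/lpa_piP/rel_addA.
Qed.
Fact lpa_addC : commutative lpa_add.
Proof.
elim/lpa_ind=> s; elim/lpa_ind=> t.
by rewrite !lpa_addE; apply/lpa_piP/rel_addC.
Qed.
Fact lpa_add0 : left_id lpa_zero lpa_add.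
Proof. by elim/lpa_ind=> s; rewrite lpa_addE; apply/lpa_piP/rel_add0. Qed.
Fact lpa_addN : left_inverse lpa_zero lpa_opp lpa_add.
Proof. by elim/lpa_ind=> s; rewrite lpa_oppE lpa_addE; apply/lpa_piP/rel_addN. Qed.

HB.instance Definition _ := GRing.isZmodule.Build lpa lpa_addA lpa_addC lpa_add0 lpa_addN.

Fact lpa_scaleA k l x : lpa_scale k (lpa_scale l x) = lpa_scale (k * l) x.
Proof.
by elim/lpa_ind: x => s; rewrite !lpa_scaleE; apply/lpa_piP/rel_scaleA.
Qed.
Fact lpa_scale1 : left_id 1 lpa_scale.
Proof. by elim/lpa_ind=> s; rewrite lpa_scaleE; apply/lpa_piP/rel_scale1. Qed.
Fact lpa_scaleDr : right_distributive lpa_scale +%R.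
Proof.
move=> k; elim/lpa_ind=> s; elim/lpa_ind=> t.
by rewrite /GRing.add /= !(lpa_addE, lpa_scaleE); apply/lpa_piP/rel_scaleDr.
Qed.
Fact lpa_scaleDl x : {morph lpa_scale^~ x : k l / k + l}.
Proof.
move=> k l; elim/lpa_ind: x => s.
by rewrite [RHS]/GRing.add /= !lpa_scaleE lpa_addE; apply/lpa_piP/rel_scaleDl.
Qed.

HB.instance Definition _ :=
  GRing.Zmodule_isLmodule.Build K lpa lpa_scaleA lpa_scale1 lpa_scaleDr lpa_scaleDl.

Lemma lpa_pi0 : lpa_pi TZero = 0. Proof. by []. Qed.
Lemma lpa_piD s t : lpa_pi (TAdd s t) = lpa_pi s + lpa_pi t.
Proof. by rewrite -lpa_addE. Qed.
Lemma lpa_piN s : lpa_pi (TOpp s) = - lpa_pi s.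
Proof. by rewrite -lpa_oppE. Qed.
Lemma lpa_piZ k s : lpa_pi (TScale k s) = k *: lpa_pi s.
Proof. by rewrite -lpa_scaleE. Qed.
Lemma lpa_piM s t : lpa_pi (TMul s t) = lpa_mul (lpa_pi s) (lpa_pi t).
Proof. by apply/esym/lpa_piP/rel_mul; apply: lpa_repr_pi. Qed.

Lemma lpa_mulA : associative lpa_mul.
Proof.
elim/lpa_ind=> s; elim/lpa_ind=> t; elim/lpa_ind=> u.
by rewrite -!lpa_piM; apply/lpa_piP/rel_mulA.
Qed.
Lemma lpa_mulDl : left_distributive lpa_mul +%R.
Proof.
elim/lpa_ind=> s; elim/lpa_ind=> t; elim/lpa_ind=> u.
by rewrite -!(lpa_piD, lpa_piM); apply/lpa_piP/rel_mulDl.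
Qed.
Lemma lpa_mulDr : right_distributive lpa_mul +%R.
Proof.
elim/lpa_ind=> s; elim/lpa_ind=> t; elim/lpa_ind=> u.
by rewrite -!(lpa_piD, lpa_piM); apply/lpa_piP/rel_mulDr.
Qed.
Lemma lpa_scaleAl k x y : k *: lpa_mul x y = lpa_mul (k *: x) y.
Proof.
elim/lpa_ind: x => s; elim/lpa_ind: y => t.
by rewrite -(lpa_piM s t) -!lpa_piZ -lpa_piM; apply/lpa_piP/rel_scaleAl.
Qed.
Lemma lpa_scaleAr k x y : k *: lpa_mul x y = lpa_mul x (k *: y).
Proof.
elim/lpa_ind: x => s; elim/lpa_ind: y => t.
by rewrite -(lpa_piM s t) -!lpa_piZ -lpa_piM; apply/lpa_piP/rel_scaleAr.
Qed.

Definition vtx (v : vertex E) : lpa := lpa_pi (TVtx v).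
Definition edg (e : edge E) : lpa := lpa_pi (TEdge e).
Definition ghost (e : edge E) : lpa := lpa_pi (TGhost e).

Lemma lpa_ck v : regular v ->
  vtx v = \sum_(e <- fset_set (out v)) lpa_mul (edg e) (ghost e).
Proof.
move=> /(@rel_ck E K)/lpa_piP; rewrite -/(vtx v) => ->.
elim: (enum_fset _) => [|e es IH] /=; first by rewrite big_nil.
by rewrite big_cons lpa_piD lpa_piM IH.
Qed.

(* The homogeneous components of the Z-grading, as the least family of subspaces
   that is compatible with products and gives the generators their degrees. *)
Inductive homog : int -> lpa -> Prop :=
| homog_vtx v : homog 0 (vtx v)
| homog_edg e : homog 1 (edg e)
| homog_ghost e : homog (- 1) (ghost e)
| homog_0 n : homog n 0
| homog_add n x y : homog n x -> homog n y -> homog n (x + y)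
| homog_scale n k x : homog n x -> homog n (k *: x)
| homog_mul m n x y : homog m x -> homog n y -> homog (m + n) (lpa_mul x y).

Definition left_ideal (S : set lpa) :=
  [/\ S 0,
      forall x y, S x -> S y -> S (x - y) &
      forall x y, S y -> S (lpa_mul x y)].

(* The second condition says that S is the sum of its homogeneous components. *)
Definition graded_left_ideal (S : set lpa) :=
  left_ideal S /\
  forall x, S x -> exists (d : seq int) (c : int -> lpa),
    (forall n, S (c n) /\ homog n (c n)) /\ x = \sum_(n <- d) c n.

Definition minimal_graded_left_ideal (S : set lpa) :=
  [/\ graded_left_ideal S,
      S <> [set 0] &
      forall T, graded_left_ideal T -> T `<=` S -> T = [set 0] \/ T = S].

Definition left_principal (a : lpa) : set lpa := [set lpa_mul x a | x in setT].

(* A graded left L-module whose underlying module is a left ideal of L, with a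
   grading that need not be the one induced by L, so as to allow shifts. *)
Record graded_module := GradedModule {
  gm_set : set lpa;
  gm_deg : int -> set lpa }.

Definition ideal_module (S : set lpa) : graded_module :=
  GradedModule S (fun n => S `&` homog n).

Definition gm_shift (M : graded_module) (k : int) : graded_module :=
  GradedModule (gm_set M) (fun n => gm_deg M (k + n)).

(* The values of f outside of the left ideal underlying M are irrelevant. *)
Definition gm_iso (M N : graded_module) := exists f : lpa -> lpa,
  [/\ forall x y, gm_set M x -> gm_set M y -> f (x + y) = f x + f y,
      forall x y, gm_set M y -> f (lpa_mul x y) = lpa_mul x (f y),
      set_bij (gm_set M) (gm_set N) f &
      forall n x, gm_deg M n x -> gm_deg N n (f x)].

End Algebra.

(* Main.v *)
Require Import Defs.
From mathcomp Require Import all_boot all_order all_algebra finmap.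
From mathcomp Require Import boolp classical_sets cardinality.

Set Implicit Arguments.
Unset Strict Implicit.
Unset Printing Implicit Defensive.

(** Both kinds of vertices in the theorem are captured by one condition: [u] is
    a line point or a Laurent vertex exactly when no vertex of [tree u] is a
    bifurcation ([line_or_laurentP]).  Indeed, in an unbranched tree the path
    leaving [u] is forced; either it never meets a cycle, or it runs into one,
    which then has no exit and beyond which nothing new is reached.

    On the algebraic side, [simple_at w] says that [w] lies in [L x] for every
    nonzero homogeneous [x] in [L w], which is how minimality of [L w] is used.
    [simple_atP] identifies it with unbranchedness of [w]:
    - if [u] is unbranched, then [u = e e*] for the only edge [e] leaving [u], if
      there is one.  So the ghost part of [x] in [L u] can be removed by
      multiplying on the right by edges, without losing information.  What
      remains is a nonzero combination of paths of the same length, from which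
      multiplication on the left by a ghost path extracts a single vertex
      (distinct paths [p], [q] of the same length satisfy [p* q = 0]);
    - conversely [simple_at] passes from [src e] to [rng e], because
      [L (rng e)] is isomorphic to the left ideal [L e*] of [L (src e)], and it
      excludes bifurcations: if [e] and [f] leave [w], then [w = a e*] gives
      [f = a e* f = 0].

    To get from an arbitrary minimal [S] to a vertex, the reduction theorem
    [homog_reduce] is used: every nonzero homogeneous [x] satisfies
    [c x b = w] for some homogeneous [c], [b] and some vertex [w].  For [x] in
    [S] put [a = w c x]; then [S = L a], and right multiplication by [b] is an
    isomorphism from [L a] onto [L w] whose inverse is right multiplication by
    [a].  Both here and in the characterization of [simple_at] it is essential
    that vertices are nonzero in [L] ([vtx_neq0]), which is seen on an explicit
    module. *)

Import GRing.Theory.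
Local Open Scope classical_set_scope.
Local Open Scope ring_scope.

Local Notation "x ** y" := (lpa_mul x y) (at level 40, left associativity).

(** * Unbranched vertices *)
Section Unbranched.
Variable E : digraph.
Implicit Types (u v w x : vertex E) (e : edge E) (p : seq (edge E)).

Definition unbranched u := forall x, tree u x -> ~ bifurcation x.

Lemma is_path_cat u v w p q :
  is_path u p v -> is_path v q w -> is_path u (p ++ q) w.
Proof.
elim: p u => [|e p IH] u /=; first by move=> ->.
by case=> eu pv qw; split=> //; apply: IH.
Qed.

Lemma tree_refl u : tree u u. Proof. by exists [::]. Qed.

Lemma tree_trans u v w : tree u v -> tree v w -> tree u w.
Proof. by case=> p pv [q qw]; exists (p ++ q); apply: is_path_cat pv qw. Qed.

Lemma tree_edge e : tree (src e) (rng e).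
Proof. by exists [:: e]. Qed.

Lemma unbranched_edge e : unbranched (src e) -> unbranched (rng e).
Proof. by move=> ub x ex; apply/ub/(tree_trans (tree_edge e)). Qed.

Lemma tree_path_vertices u p w x :
  is_path u p w -> x \in path_vertices u p -> tree u x.
Proof.
elim: p u => [|e p IH] u /=; first by rewrite inE => _ /eqP->; apply: tree_refl.
case=> <- pw; rewrite inE => /orP[/eqP->|]; first exact: tree_refl.
by move=> xp; apply: (tree_trans (tree_edge e)); apply: IH pw xp.
Qed.

Lemma tree_src_path u p w e : is_path u p w -> e \in p -> tree u (src e).
Proof.
elim: p u => //= f p IH u [<- pw]; rewrite inE => /orP[/eqP->|ep].
  exact: tree_refl.
exact: tree_trans (tree_edge f) (IH _ pw ep).
Qed.

Lemma path_vertices_src u p w x : is_path u p w -> x \in path_vertices u p ->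
  x = w \/ exists2 e, e \in p & src e = x.
Proof.
elim: p u => [|e p IH] u /=; first by rewrite inE => -> /eqP; left.
case=> eu pw; rewrite inE => /orP[/eqP->|xp].
  by right; exists e => //; rewrite mem_head.
case: (IH _ pw xp) => [|[f fp fx]]; first by left.
by right; exists f => //; rewrite inE fp orbT.
Qed.

(** The final vertex of a cycle is the source of its first edge. *)
Lemma cycle_vertices_src w c x : cycle_at w c -> x \in path_vertices w c ->
  exists2 e, e \in c & src e = x.
Proof.
case=> c0 cw _ xc; case: (path_vertices_src cw xc) => // ->.
by case: c c0 cw {xc} => // e c _ [ew _]; exists e; rewrite ?mem_head.
Qed.

(** If the tree is unbranched and contains the base [w] of a cycle [c], then the
    vertices of a path [m] from [u] to [w] followed by [c] are closed under
    outgoing edges, since each of them emits its own edge of [m ++ c] and no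
    other one.  Hence they form the whole tree. *)
Lemma line_or_laurentP u :
  line_point u \/ laurent_vertex u <-> unbranched u.
Proof.
split=> [[lu x /lu[]//|[m [w [c [mw mb cw cx tu]]]]] x|ub].
  rewrite tu /= /path_vertices map_cat -cat_cons mem_cat => /orP[/mb//|xc].
  have xwc : x \in path_vertices w c by rewrite inE xc orbT.
  have [e ec ex] := cycle_vertices_src cw xwc.
  case=> f [g [fx gx fg]]; apply: cx.
  have [fe|fe] := eqVneq f e.
    by exists g, e; split=> //; [rewrite gx ex|rewrite -fe => /esym].
  by exists f, e; split=> //; [rewrite fx ex|apply/eqP].
have [[w [tuw [c cw]]]|noc] := pselect (exists w, tree u w /\ exists c, cycle_at w c).
  right; have [m mw] := tuw; exists m, w, c.
  have [c0 pc _] := cw.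
  have pmc := is_path_cat mw pc.
  split=> //.
  - by move=> x xm; apply/ub/(tree_path_vertices mw).
  - case=> f [e [ec fe ne]]; apply: (ub (src e)); last by exists f, e.
    exact: tree_trans tuw (tree_src_path pc ec).
  apply/seteqP; split=> x /=; last exact: tree_path_vertices pmc.
  have closed y f : y \in path_vertices u (m ++ c) -> src f = y ->
      rng f \in path_vertices u (m ++ c).
    move=> ym fy; have ybif := ub y (tree_path_vertices pmc ym).
    have [g gmc gy] : exists2 g, g \in m ++ c & src g = y.
      case: (path_vertices_src pmc ym) => // ->.
      have [|g gc gw] := cycle_vertices_src cw (x := w).
        by rewrite mem_head.
      by exists g; rewrite // mem_cat gc orbT.
    suff -> : f = g by rewrite inE map_f ?orbT.
    by apply: contrapT => ne; apply: ybif; exists f, g.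
  case=> p; have: u \in path_vertices u (m ++ c) by rewrite mem_head.
  move: {1 3}u; elim: p => [|e p IH] y ym /=; first by move=> <-.
  by case=> ey; apply: IH; apply: closed ym ey.
left=> w tuw; split; first exact: ub.
by move=> wc; apply: noc; exists w.
Qed.

End Unbranched.

(** * Vertices are nonzero *)
Section Representation.
Variables (E : digraph) (K : fieldType).
Local Notation cell := (nat * seq (edge E))%type.
Local Notation func := (vertex E -> cell -> K).
Implicit Types (e : edge E) (z : cell) (f : func).

Definition out_seq (v : vertex E) : seq (edge E) := fset_set (out v).

(** The module consists of all functions on the set of pairs of a vertex and a
    cell, so that each vertex owns a copy of the set of cells.  The map
    [encode e] embeds the cells of [rng e] into those of [src e], with disjoint
    images for distinct edges leaving the same vertex.  At a regular vertex with
    [n] outgoing edges these images must also cover everything, which the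
    residue classes modulo [n] of the first component achieve.  At other
    vertices only disjointness is needed, and it is obtained by storing the edge,
    which works for any number of edges. *)
Definition encode e z : cell :=
  if `[< regular (src e) >]
  then ((z.1 * size (out_seq (src e)) + index e (out_seq (src e)))%N, z.2)
  else (z.1, e :: z.2).

Definition decode e z : option cell :=
  if `[< regular (src e) >] then
    if (z.1 %% size (out_seq (src e)) == index e (out_seq (src e)))%N
    then Some ((z.1 %/ size (out_seq (src e)))%N, z.2) else None
  else if z.2 is e' :: w then if e' == e then Some (z.1, w) else None
  else None.

Lemma mem_out_seq v e : regular v -> (e \in out_seq v) = (src e == v).
Proof. by case=> fv _; rewrite in_fset_set. Qed.

Lemma index_out_seq e : regular (src e) ->
  (index e (out_seq (src e)) < size (out_seq (src e)))%N.
Proof. by move=> re; rewrite index_mem mem_out_seq. Qed.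

Lemma encodeK e z : decode e (encode e z) = Some z.
Proof.
rewrite /decode /encode; case: z => k w; case: asboolP => [re|nre] /=.
  have lt := index_out_seq re; have gt0 : (0 < size (out_seq (src e)))%N.
    exact: (leq_ltn_trans (leq0n _) lt).
  by rewrite modnMDl modn_small // eqxx divnMDl // divn_small // addn0.
by rewrite eqxx.
Qed.

Lemma decodeK e z z' : decode e z = Some z' -> encode e z' = z.
Proof.
rewrite /decode /encode; case: z => k w; case: asboolP => [re|nre] /=.
  by case: eqP => // <- [<-] /=; rewrite -divn_eq.
by case: w => // e' w; case: eqP => // -> [<-].
Qed.

Lemma decode_encode_neq e e' z :
  src e = src e' -> e <> e' -> decode e (encode e' z) = None.
Proof.
rewrite /decode /encode => ee ne; rewrite ee; case: asboolP => [re|nre] /=.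
  rewrite modnMDl modn_small; last exact: index_out_seq.
  case: eqP => // /esym ie; have e'in : e' \in out_seq (src e') by rewrite mem_out_seq.
  case: ne; have := nth_index e e'in; rewrite -ie nth_index //.
  by rewrite mem_out_seq // ee.
by case: eqP => // /esym.
Qed.

Lemma decode_regular v z : regular v ->
  exists2 e, e \in out_seq v & exists z', decode e z = Some z'.
Proof.
move=> rv; have [e0 e0v] : out v !=set0 by case: rv.
pose e := nth e0 (out_seq v) (z.1 %% size (out_seq v)).
have lt : (z.1 %% size (out_seq v) < size (out_seq v))%N.
  apply/ltn_pmod/(leq_ltn_trans (leq0n (index e0 (out_seq v)))).
  by rewrite index_mem mem_out_seq //; apply/eqP.
have ein : e \in out_seq v by rewrite mem_nth.
exists e => //; have /eqP ev : src e == v by rewrite -mem_out_seq.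
rewrite /decode ev asboolT //.
by rewrite /e index_uniq ?fset_uniq // eqxx; eexists.
Qed.

(** A ghost edge restricts a function along [encode e], and an edge is extension
    by zero along it, that is, the opposite partial inverse. *)
Fixpoint act (t : lpa_term E K) (f : func) : func :=
  match t with
  | TVtx v => fun y z => if y == v then f y z else 0
  | TEdge e => fun y z => if y == src e then
      (if decode e z is Some z' then f (rng e) z' else 0) else 0
  | TGhost e => fun y z => if y == rng e then f (src e) (encode e z) else 0
  | TZero => fun _ _ => 0
  | TAdd s t => fun y z => act s f y z + act t f y z
  | TOpp s => fun y z => - act s f y z
  | TScale k s => fun y z => k * act s f y z
  | TMul s t => act s (act t f)
  end.

Lemma actD t f g : act t (fun y z => f y z + g y z) =
  fun y z => act t f y z + act t g y z.
Proof.
elim: t f g => [v|e|e||s IHs t IHt|s IHs|k s IHs|s IHs t IHt] f g /=;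
  last by rewrite IHt IHs.
all: apply/funext=> y; apply/funext=> z.
- by case: eqP; rewrite ?addr0.
- by case: eqP; rewrite ?addr0 //; case: decode; rewrite ?addr0.
- by case: eqP; rewrite ?addr0.
- by rewrite addr0.
- by rewrite IHs IHt addrACA.
- by rewrite IHs opprD.
- by rewrite IHs mulrDr.
Qed.

Lemma actZ t k f : act t (fun y z => k * f y z) = fun y z => k * act t f y z.
Proof.
elim: t k f => [v|e|e||s IHs t IHt|s IHs|k' s IHs|s IHs t IHt] k f /=;
  last by rewrite IHt IHs.
all: apply/funext=> y; apply/funext=> z.
- by case: eqP; rewrite ?mulr0.
- by case: eqP; rewrite ?mulr0 //; case: decode; rewrite ?mulr0.
- by case: eqP; rewrite ?mulr0.
- by rewrite mulr0.
- by rewrite IHs IHt mulrDr.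
- by rewrite IHs mulrN.
- by rewrite IHs mulrCA.
Qed.

Lemma act_TSum (ts : seq (lpa_term E K)) f y z :
  act (TSum ts) f y z = \sum_(t <- ts) act t f y z.
Proof. by elim: ts => [|t ts IH] /=; rewrite ?big_nil ?big_cons ?IH. Qed.

(** The covering property of [encode] enters in the Cuntz-Krieger relation at a
    regular vertex: it says that the sum over the outgoing edges of the
    restrictions of a function to these images is the function itself. *)
Lemma act_rel s t : lpa_rel s t -> act s = act t.
Proof.
elim=> {s t} //=.
- by move=> s t u _ -> _ ->.
- by move=> s s' t t' _ -> _ ->.
- by move=> s s' _ ->.
- by move=> k s s' _ ->.
- by move=> s s' t t' _ -> _ ->.
all: intros; apply/funext=> h; (try by rewrite ?(actD, actZ));
  apply/funext=> y; apply/funext=> z /=.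
- by rewrite addrA.
- by rewrite addrC.
- by rewrite add0r.
- by rewrite addNr.
- by rewrite mulrA.
- by rewrite mul1r.
- by rewrite mulrDr.
- by rewrite mulrDl.
- by case: eqP.
- by case: eqP => // ->; case: eqP.
- by case: eqP.
- by case: eqP => //; case: decode => //= *; rewrite eqxx.
- by case: eqP.
- by rewrite eqxx.
- by case: eqP => // ->; rewrite eqxx encodeK.
- case: eqP => // _; case: eqP => // ef; rewrite decode_encode_neq //; exact: nesym.
rewrite act_TSum big_map -/(out_seq v).
have rv : regular v by [].
case: eqP => [->|ne]; last first.
  rewrite big_seq big1 // => e; rewrite mem_out_seq //= => /eqP->.
  by case: eqP.
have [e ev [z' ez]] := decode_regular z rv.
have se e' : e' \in out_seq v -> src e' = v by rewrite mem_out_seq // => /eqP.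
rewrite (bigD1_seq e) ?fset_uniq //= big_seq_cond big1 ?addr0.
  by rewrite se // eqxx ez eqxx (decodeK ez).
move=> e' /andP[e'v ne]; rewrite !se // eqxx.
by rewrite -(decodeK ez) decode_encode_neq ?se //; apply/eqP.
Qed.

(** The vertex acts on the constant function 1 as an indicator function. *)
Lemma vtx_neq0 (v : vertex E) : vtx K v <> 0.
Proof.
rewrite -(lpa_pi0 E K) => /lpa_piP/act_rel/(congr1 (fun F => F (fun _ _ => 1) v (0%N, [::]))) /=.
by rewrite eqxx => /eqP; rewrite oner_eq0.
Qed.

End Representation.

(** * Locally finite sums *)
Section LocallyFinite.
Variables (I : eqType) (V : zmodType) (T : I -> V -> V).

(** Stating the equality for all large finite sets of indices, instead of for
    one such set, makes the property additive in [x] even though no finite set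
    serves all [x]. *)
Definition locally_sum (x : V) := exists F0 : seq I,
  forall F, uniq F -> {subset F0 <= F} -> \sum_(i <- F) T i x = x.

Lemma locally_sum0 : (forall i, T i 0 = 0) -> locally_sum 0.
Proof. by move=> T0; exists [::] => F _ _; rewrite big1. Qed.

Lemma locally_sumD x y : (forall i, T i (x + y) = T i x + T i y) ->
  locally_sum x -> locally_sum y -> locally_sum (x + y).
Proof.
move=> TD [F1 H1] [F2 H2]; exists (F1 ++ F2) => F uF sub.
rewrite (eq_bigr _ (fun i _ => TD i)) big_split /= H1 ?H2 //.
  by move=> i iF; apply: sub; rewrite mem_cat iF orbT.
by move=> i iF; apply: sub; rewrite mem_cat iF.
Qed.

Lemma locally_sum1 j x :
  T j x = x -> (forall i, i != j -> T i x = 0) -> locally_sum x.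
Proof.
move=> Tj Ti; exists [:: j] => F uF sub.
rewrite (bigD1_seq j) //= ?sub ?mem_head // Tj big1 ?addr0 //.
Qed.

Lemma locally_sum_eq0 x : locally_sum x -> (forall i, T i x = 0) -> x = 0.
Proof.
case=> F0 sumF Tx; rewrite -(sumF (undup F0)) ?undup_uniq ?big1 //.
by move=> i; rewrite mem_undup.
Qed.

End LocallyFinite.

(** * Computing with the generators *)
Section Algebra.
Variables (E : digraph) (K : fieldType).
Local Notation L := (lpa E K).
Local Notation vtx := (vtx K).
Local Notation edg := (edg K).
Local Notation ghost := (ghost K).
Implicit Types (u v w : vertex E) (e f : edge E) (x y z a b : L).

Lemma lpa_mul0l x : 0 ** x = 0.
Proof. by apply: (addrI (0 ** x)); rewrite -lpa_mulDl !addr0. Qed.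

Lemma lpa_mul0r x : x ** 0 = 0.
Proof. by apply: (addrI (x ** 0)); rewrite -lpa_mulDr !addr0. Qed.

Lemma lpa_mulBl x y z : (x - y) ** z = x ** z - y ** z.
Proof. by apply: (addIr (y ** z)); rewrite -lpa_mulDl !subrK. Qed.

Lemma lpa_mul_suml (I : Type) (r : seq I) (P : pred I) (F : I -> L) x :
  (\sum_(i <- r | P i) F i) ** x = \sum_(i <- r | P i) F i ** x.
Proof. exact: (big_morph (fun y => y ** x) (fun y z => lpa_mulDl y z x) (lpa_mul0l x)). Qed.

Lemma lpa_mul_sumr (I : Type) (r : seq I) (P : pred I) (F : I -> L) x :
  x ** (\sum_(i <- r | P i) F i) = \sum_(i <- r | P i) x ** F i.
Proof. exact: (big_morph (lpa_mul x) (lpa_mulDr x) (lpa_mul0r x)). Qed.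

Lemma vtxM v : vtx v ** vtx v = vtx v.
Proof. by rewrite -lpa_piM; apply/lpa_piP/rel_vv. Qed.
Lemma vtxM_neq v w : v <> w -> vtx v ** vtx w = 0.
Proof. by move=> vw; rewrite -lpa_piM; apply/lpa_piP/rel_vw. Qed.
Lemma src_edg e : vtx (src e) ** edg e = edg e.
Proof. by rewrite -lpa_piM; apply/lpa_piP/rel_se. Qed.
Lemma edg_rng e : edg e ** vtx (rng e) = edg e.
Proof. by rewrite -lpa_piM; apply/lpa_piP/rel_er. Qed.
Lemma rng_ghost e : vtx (rng e) ** ghost e = ghost e.
Proof. by rewrite -lpa_piM; apply/lpa_piP/rel_rg. Qed.
Lemma ghost_src e : ghost e ** vtx (src e) = ghost e.
Proof. by rewrite -lpa_piM; apply/lpa_piP/rel_gs. Qed.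
Lemma ghost_edg e : ghost e ** edg e = vtx (rng e).
Proof. by rewrite -lpa_piM; apply/lpa_piP/rel_ge. Qed.
Lemma ghost_edg_neq e f : e <> f -> ghost e ** edg f = 0.
Proof. by move=> ef; rewrite -lpa_piM; apply/lpa_piP/rel_gf. Qed.

Lemma edg_neq0 e : edg e <> 0.
Proof.
by move=> e0; apply: (@vtx_neq0 E K (rng e)); rewrite -ghost_edg e0 lpa_mul0r.
Qed.

Lemma ghost_neq0 e : ghost e <> 0.
Proof.
by move=> e0; apply: (@vtx_neq0 E K (rng e)); rewrite -ghost_edg e0 lpa_mul0l.
Qed.

Lemma mul_vtx_neq x v w : x ** vtx v = x -> v <> w -> x ** vtx w = 0.
Proof. by move=> <- vw; rewrite -lpa_mulA vtxM_neq // lpa_mul0r. Qed.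

Lemma mul_edg_neq x v e : x ** vtx v = x -> src e <> v -> x ** edg e = 0.
Proof.
by move=> xv /nesym ve; rewrite -src_edg lpa_mulA (mul_vtx_neq xv ve) lpa_mul0l.
Qed.

Lemma mul_ghost_neq x v e : x ** vtx v = x -> rng e <> v -> x ** ghost e = 0.
Proof.
by move=> xv /nesym ve; rewrite -rng_ghost lpa_mulA (mul_vtx_neq xv ve) lpa_mul0l.
Qed.

(** Since [x = x v] and [v] is the sum of the [e e*], some [x e e*] is nonzero. *)
Lemma mul_regular_neq0 x v : regular v -> x ** vtx v = x -> x <> 0 ->
  exists2 e, src e = v & x ** edg e <> 0.
Proof.
move=> rv xv x0; apply: contrapT => none; apply: x0.
rewrite -xv (lpa_ck K rv) lpa_mul_sumr big_seq big1 // => e ev.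
rewrite lpa_mulA; have [->|/eqP xe] := eqVneq (x ** edg e) 0.
  by rewrite lpa_mul0l.
by case: none; exists e => //; apply/eqP; rewrite -(mem_out_seq _ rv).
Qed.

(** * Combinations of paths *)

(** The span of the paths of length [n] ending at [w].  Edges are added on the
    left, so that inductions follow left multiplication by ghost edges; edges
    that do not compose contribute zero. *)
Inductive path_span w : nat -> L -> Prop :=
| path_span_vtx k : path_span w 0 (k *: vtx w)
| path_span_edg n e x : path_span w n x -> path_span w n.+1 (edg e ** x)
| path_span_0 n : path_span w n 0
| path_span_add n x y :
    path_span w n x -> path_span w n y -> path_span w n (x + y).

Lemma path_span_vtxl w n v x : path_span w n x -> path_span w n (vtx v ** x).
Proof.
elim=> {n x} [k|n e x xw _|n|n x y _ IHx _ IHy].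
- rewrite -lpa_scaleAr; have [->|/eqP ne] := eqVneq v w.
    by rewrite vtxM; apply: path_span_vtx.
  by rewrite vtxM_neq // scaler0; apply: path_span_0.
- rewrite lpa_mulA; have [->|/eqP ne] := eqVneq v (src e).
    by rewrite src_edg; apply: path_span_edg.
  by rewrite -src_edg lpa_mulA vtxM_neq // !lpa_mul0l; apply: path_span_0.
- by rewrite lpa_mul0r; apply: path_span_0.
- by rewrite lpa_mulDr; apply: path_span_add.
Qed.

Lemma path_span_vtxr w n x : path_span w n x -> x ** vtx w = x.
Proof.
elim=> {n x} [k|n e x xw IH|n|n x y _ IHx _ IHy].
- by rewrite -lpa_scaleAl vtxM.
- by rewrite -lpa_mulA IH.
- by rewrite lpa_mul0l.
- by rewrite lpa_mulDl IHx IHy.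
Qed.

Lemma path_span_ghostl w n e x :
  path_span w n.+1 x -> path_span w n (ghost e ** x).
Proof.
move Em : n.+1 => m xm; elim: xm n Em => {m x} [k|m f x xw _|m|m x y _ IHx _ IHy] n //.
- case=> ->; rewrite lpa_mulA; have [->|/eqP ne] := eqVneq e f.
    by rewrite ghost_edg; apply: path_span_vtxl.
  by rewrite ghost_edg_neq // lpa_mul0l; apply: path_span_0.
- by move=> _; rewrite lpa_mul0r; apply: path_span_0.
- by move=> nm; rewrite lpa_mulDr; apply: path_span_add; [apply: IHx|apply: IHy].
Qed.

Lemma path_spanZ w n k x : path_span w n x -> path_span w n (k *: x).
Proof.
elim=> {n x} [l|n e x _ IH|n|n x y _ IHx _ IHy].
- by rewrite scalerA; apply: path_span_vtx.
- by rewrite lpa_scaleAr; apply: path_span_edg.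
- by rewrite scaler0; apply: path_span_0.
- by rewrite scalerDr; apply: path_span_add.
Qed.

Lemma path_span_edgr e n x :
  path_span (src e) n x -> path_span (rng e) n.+1 (x ** edg e).
Proof.
elim=> {n x} [k|n f x _ IH|n|n x y _ IHx _ IHy].
- rewrite -lpa_scaleAl src_edg; apply: path_spanZ.
  rewrite -edg_rng -[vtx _]scale1r; apply/path_span_edg/path_span_vtx.
- by rewrite -lpa_mulA; apply: path_span_edg.
- by rewrite lpa_mul0l; apply: path_span_0.
- by rewrite lpa_mulDl; apply: path_span_add.
Qed.

Lemma path_span0_scalar w x : path_span w 0 x -> exists k, x = k *: vtx w.
Proof.
move Em : 0%N => m xm; elim: xm Em => {m x} [k|//|n|n x y _ IHx _ IHy] n0.
- by exists k.
- by exists 0; rewrite scale0r.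
- by have [[k ->] [l ->]] := (IHx n0, IHy n0); exists (k + l); rewrite scalerDl.
Qed.

(** On a path that starts with [e], left multiplication by [f f*] is the
    identity if [f] is [e] and zero otherwise. *)
Lemma path_span_locally_sum w n x : path_span w n.+1 x ->
  locally_sum (fun e y => edg e ** (ghost e ** y)) x.
Proof.
move Em : n.+1 => m xm; elim: xm Em => {m x} [//|m e x _ _|m|m x y _ IHx _ IHy] nm.
- apply: (locally_sum1 (j := e)).
    by rewrite [ghost e ** _]lpa_mulA ghost_edg lpa_mulA edg_rng.
  move=> f /eqP fe.
  by rewrite [ghost f ** _]lpa_mulA ghost_edg_neq // lpa_mul0l lpa_mul0r.
- by apply: locally_sum0 => e; rewrite !lpa_mul0r.
- apply: locally_sumD; [|exact: IHx|exact: IHy].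
  by move=> e; rewrite !lpa_mulDr.
Qed.

(** As [x] is the sum of the [e e* x], some [e* x] is nonzero, and it is a
    combination of shorter paths; the induction stops at a multiple of [w]. *)
Lemma path_span_reduce w n x : path_span w n x -> x <> 0 ->
  exists d a, homog d a /\ a ** x = vtx w.
Proof.
elim: n x => [|n IH] x xw x0.
  have [k xk] := path_span0_scalar xw; exists 0, (k^-1 *: vtx w).
  split; first exact/homog_scale/homog_vtx.
  have k0 : k != 0 by apply/eqP => k0; apply: x0; rewrite xk k0 scale0r.
  by rewrite xk -lpa_scaleAl -lpa_scaleAr scalerA mulVf // scale1r vtxM.
have [e ex] : exists e, ghost e ** x <> 0.
  apply: contrapT => none; apply: x0.
  apply: (locally_sum_eq0 (path_span_locally_sum xw)) => e.
  have [->|/eqP ex] := eqVneq (ghost e ** x) 0; first by rewrite lpa_mul0r.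
  by case: none; exists e.
have [d [a [da ax]]] := IH _ (path_span_ghostl e xw) ex.
exists (d + - 1), (a ** ghost e); split; last by rewrite -lpa_mulA.
exact/homog_mul/homog_ghost.
Qed.

(** The same span, with a degree in [int]; there are no paths of negative
    length. *)
Definition real_span (d : int) w x :=
  if d is Posz n then path_span w n x else x = 0.

Lemma real_span_0 d w : real_span d w 0.
Proof. by case: d => n //; apply: path_span_0. Qed.

Lemma real_span_add d w x y :
  real_span d w x -> real_span d w y -> real_span d w (x + y).
Proof. by case: d => n /=; [apply: path_span_add|move=> -> ->; rewrite addr0]. Qed.

Lemma real_span_scale d w k x : real_span d w x -> real_span d w (k *: x).
Proof. by case: d => n /=; [apply: path_spanZ|move=> ->; rewrite scaler0]. Qed.

Lemma real_span_edgr d e x :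
  real_span d (src e) x -> real_span (d + 1) (rng e) (x ** edg e).
Proof.
case: d => n; first by rewrite addrC -intS; apply: path_span_edgr.
by move=> /= ->; rewrite lpa_mul0l; apply: real_span_0.
Qed.

Lemma real_span_vtxr d w x : real_span d w x -> x ** vtx w = x.
Proof.
by case: d => n /=; [apply: path_span_vtxr|move=> ->; rewrite lpa_mul0l].
Qed.

Lemma real_span_reduce d w x : real_span d w x -> x <> 0 ->
  exists m a, homog m a /\ a ** x = vtx w.
Proof. by case: d => n //=; apply: path_span_reduce. Qed.

(** Otherwise a left multiple of [x] would be the vertex [src e], and the same
    multiple of [x e] would be [e], which is nonzero. *)
Lemma real_span_edg_eq0 d e x : real_span d (src e) x -> x ** edg e = 0 -> x = 0.
Proof.
move=> xe xe0; apply: contrapT => /(real_span_reduce xe)[m [a [_ ax]]].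
by apply: (@edg_neq0 e); rewrite -src_edg -ax -lpa_mulA xe0 lpa_mul0r.
Qed.

(** * Combinations of monomials *)

(** The span of the monomials [p q*] of degree [d] where [q] starts at [v] and
    has length at most [N].  Ghost edges are added on the right, since it is on
    the right that the reduction removes them. *)
Inductive mono_span : nat -> int -> vertex E -> L -> Prop :=
| mono_span_real N d v x : real_span d v x -> mono_span N d v x
| mono_span_ghost N d e x :
    mono_span N d (rng e) x -> mono_span N.+1 (d - 1) (src e) (x ** ghost e)
| mono_span_add N d v x y :
    mono_span N d v x -> mono_span N d v y -> mono_span N d v (x + y).

Lemma mono_span_0 N d v : mono_span N d v 0.
Proof. exact/mono_span_real/real_span_0. Qed.

Lemma mono_span_vtxr N d v x : mono_span N d v x -> x ** vtx v = x.
Proof.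
elim=> {N d v x} [N d v x xv|N d e x _ _|N d v x y _ IHx _ IHy].
- exact: real_span_vtxr xv.
- by rewrite -lpa_mulA ghost_src.
- by rewrite lpa_mulDl IHx IHy.
Qed.

Lemma mono_span_scale N d v k x : mono_span N d v x -> mono_span N d v (k *: x).
Proof.
elim=> {N d v x} [N d v x xv|N d e x _ IH|N d v x y _ IHx _ IHy].
- exact/mono_span_real/real_span_scale.
- by rewrite lpa_scaleAl; apply: mono_span_ghost.
- by rewrite scalerDr; apply: mono_span_add.
Qed.

Lemma mono_spanS N d v x : mono_span N d v x -> mono_span N.+1 d v x.
Proof.
elim=> {N d v x} [N d v x xv|N d e x _ IH|N d v x y _ IHx _ IHy].
- exact/mono_span_real.
- exact/mono_span_ghost.
- exact/mono_span_add.
Qed.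

Lemma mono_span_leq M N d v x :
  (N <= M)%N -> mono_span N d v x -> mono_span M d v x.
Proof.
by move/subnK<-; elim: (M - N)%N => // n IH xv; rewrite addSn; apply/mono_spanS/IH.
Qed.

(** Right multiplication by [e] cancels a final [e*], so it lowers the bound on
    the ghost part; this is what makes the reduction terminate. *)
Lemma mono_span_edgr N d v e x : src e = v ->
  mono_span N d v x -> mono_span N.-1 (d + 1) (rng e) (x ** edg e).
Proof.
move=> ev xv; elim: xv ev => {N d v x} [N d v x xv|N d f x xf _|N d v x y _ IHx _ IHy] ev.
- by apply/mono_span_real/real_span_edgr; rewrite ev.
- rewrite subrK -lpa_mulA /=; have [fe|/eqP ne] := eqVneq f e.
    by rewrite -fe ghost_edg (mono_span_vtxr xf).
  by rewrite ghost_edg_neq // lpa_mul0r; apply: mono_span_0.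
- by rewrite lpa_mulDl; apply: mono_span_add; [apply: IHx|apply: IHy].
Qed.

Lemma mono_span0_real d v x : mono_span 0 d v x -> real_span d v x.
Proof.
move EN : 0%N => N xv.
elim: xv EN => {N d v x} [N d v x xv|//|N d v x y _ IHx _ IHy] N0 //.
by apply: real_span_add; [apply: IHx|apply: IHy].
Qed.

(** Right multiplication by [f f*] fixes the monomials whose ghost part ends
    with [f*] and kills those that end with another ghost edge.  Nothing of the
    kind holds for the monomials without ghost part, which form [x0]. *)
Lemma mono_span_split N d v x : mono_span N d v x ->
  exists2 x0, real_span d v x0 &
    locally_sum (fun e y => y ** edg e ** ghost e) (x - x0).
Proof.
have T0 e : 0 ** edg e ** ghost e = 0 by rewrite !lpa_mul0l.
elim=> {N d v x} [N d v x xv|N d e x xe _|N d v x y _ [x0 rx sx] _ [y0 ry sy]].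
- by exists x => //; rewrite subrr; apply: locally_sum0.
- exists 0; rewrite ?subr0; first exact: real_span_0.
  apply: (locally_sum1 (j := e)).
    by rewrite -[_ ** edg e]lpa_mulA ghost_edg (mono_span_vtxr xe).
  move=> f /eqP/nesym fe.
  by rewrite -[_ ** edg f]lpa_mulA ghost_edg_neq // lpa_mul0r lpa_mul0l.
- exists (x0 + y0); first exact: real_span_add.
  rewrite opprD addrACA; apply: locally_sumD sx sy.
  by move=> e; rewrite !lpa_mulDl.
Qed.

(** Suppose that [x e] is zero for all edges [e], and let [y] be the part of [x]
    without ghost edges, so that [x - y] is the sum of the [(x - y) f f*] for [f]
    in a finite set [F0].  If all edges leaving [v] are in [F0], then [v] is
    regular or a sink; the former is excluded by [mul_regular_neq0], and in the
    latter case [x = y].  If some edge [f] leaving [v] is not in [F0], then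
    [(x - y) f = 0], hence [y f = 0], so [y = 0] because right multiplication by
    an edge is injective on combinations of paths; but then [x] is a sum of
    elements [x f f*], all zero. *)
Lemma mono_span_edg_neq0 N d v x : mono_span N d v x -> x <> 0 ->
  real_span d v x \/ exists2 e, src e = v & x ** edg e <> 0.
Proof.
move=> xv x0; have xvv := mono_span_vtxr xv.
have [|none] := pselect (exists2 e, src e = v & x ** edg e <> 0); first by right.
left; have xe e : x ** edg e = 0.
  have [ev|/eqP ev] := eqVneq (src e) v; last exact: mul_edg_neq xvv ev.
  by apply: contrapT => xe; apply: none; exists e.
have [y ry sy] := mono_span_split xv.
suff/(locally_sum_eq0 sy)/eqP : forall e, (x - y) ** edg e ** ghost e = 0.
  by rewrite subr_eq0 => /eqP->.
move=> e; have [ev|/eqP ev] := eqVneq (src e) v; last first.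
  by rewrite lpa_mulBl xe (mul_edg_neq (real_span_vtxr ry) ev) subrr lpa_mul0l.
have [F0 sumF] := sy.
have [outF|] := pselect (forall f, src f = v -> f \in F0).
  have rv : regular v.
    split; last by exists e.
    by apply: (sub_finite_set (B := [set` F0])) => // f /outF.
  by case: none; apply: mul_regular_neq0.
move=> /existsNP[f /not_implyP[fv fF]].
have yf : (x - y) ** edg f = 0.
  rewrite -(sumF (undup F0)) ?undup_uniq //; last by move=> g; rewrite mem_undup.
  rewrite lpa_mul_suml big_seq big1 // => g; rewrite mem_undup => gF.
  rewrite -lpa_mulA ghost_edg_neq ?lpa_mul0r // => gf.
  by apply: fF; rewrite -gf.
have y0 : y = 0.
  apply: (@real_span_edg_eq0 d f); first by rewrite fv.
  by apply/eqP; rewrite -oppr_eq0 -[_ == _](inj_eq (addrI (x ** edg f))) -lpa_mulBl yf addr0 xe.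
by rewrite y0 subr0 xe lpa_mul0l.
Qed.

(** Multiplying on the right by suitable edges removes the ghost part, after
    which multiplying on the left by a ghost path leaves a single vertex. *)
Lemma mono_span_reduce N d v x : mono_span N d v x -> x <> 0 ->
  exists m n a b w, [/\ homog m a, homog n b & a ** x ** b = vtx w].
Proof.
have real_case d' v' y : real_span d' v' y -> y <> 0 -> exists m n a b w,
    [/\ homog m a, homog n b & a ** y ** b = vtx w].
  move=> ry y0; have [m [a [ma ay]]] := real_span_reduce ry y0.
  exists m, 0, a, (vtx v'), v'; split=> //; first exact: homog_vtx.
  by rewrite ay vtxM.
elim: N d v x => [|N IH] d v x xv x0.
  exact: real_case (mono_span0_real xv) x0.
have [|[e ev xe]] := mono_span_edg_neq0 xv x0; first by move/real_case; apply.
have [m [n [a [b [w [ma nb axb]]]]]] := IH _ _ _ (mono_span_edgr ev xv) xe.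
exists m, (1 + n), a, (edg e ** b), w; split=> //.
  exact/homog_mul/nb/homog_edg.
by rewrite -axb !lpa_mulA.
Qed.

Inductive homog_span (d : int) : L -> Prop :=
| homog_span_0 : homog_span d 0
| homog_span_mono N v x : mono_span N d v x -> homog_span d x
| homog_span_add x y : homog_span d x -> homog_span d y -> homog_span d (x + y).

Lemma homog_span_scale d k x : homog_span d x -> homog_span d (k *: x).
Proof.
elim=> {x} [|N v x xv|x y _ IHx _ IHy].
- by rewrite scaler0; apply: homog_span_0.
- exact: (homog_span_mono (mono_span_scale k xv)).
- by rewrite scalerDr; apply: homog_span_add.
Qed.

(** It suffices to check the spanning elements, right multiplication by [y]
    being linear. *)
Lemma homog_span_mulr d n y :
    (forall N v x, mono_span N d v x -> homog_span (d + n) (x ** y)) ->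
  forall x, homog_span d x -> homog_span (d + n) (x ** y).
Proof.
move=> Hy x; elim=> {x} [|N v x xv|x z _ IHx _ IHz].
- by rewrite lpa_mul0l; apply: homog_span_0.
- exact: Hy xv.
- by rewrite lpa_mulDl; apply: homog_span_add.
Qed.

(** The two claims have to be proved together: the first one for a product
    [x y] follows from the first for [x] and the second for [y].  In this form
    only right multiplication by the generators needs to be computed. *)
Lemma homog_in_span_mulr n x : homog n x ->
  homog_span n x /\ forall d y, homog_span d y -> homog_span (d + n) (y ** x).
Proof.
elim=> {n x} [w|e|e|n|n x y _ [hx Hx] _ [hy Hy]|n k x _ [hx Hx]|m n x y _ [hx Hx] _ [hy Hy]].
- split.
    apply: (@homog_span_mono _ 0%N w); apply: (@mono_span_real 0%N 0).
    by rewrite -[vtx _]scale1r; apply: path_span_vtx.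
  move=> d; rewrite addr0; rewrite -{2}[d]addr0; apply: homog_span_mulr => N v x xv.
  have xvv := mono_span_vtxr xv; rewrite addr0.
  have [<-|/eqP vw] := eqVneq v w; first by rewrite xvv; apply: homog_span_mono xv.
  by rewrite (mul_vtx_neq xvv vw); apply: homog_span_0.
- split.
    apply: (@homog_span_mono _ 0%N (rng e)); apply: (@mono_span_real 0%N 1).
    by rewrite -edg_rng -[vtx _]scale1r; apply/path_span_edg/path_span_vtx.
  move=> d; apply: homog_span_mulr => N v x xv; have xvv := mono_span_vtxr xv.
  have [ev|/eqP ev] := eqVneq (src e) v.
    exact: homog_span_mono (mono_span_edgr ev xv).
  by rewrite (mul_edg_neq xvv ev); apply: homog_span_0.
- split.
    apply: (@homog_span_mono _ 1%N (src e)).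
    rewrite -rng_ghost -[- 1]add0r; apply/mono_span_ghost/mono_span_real.
    by rewrite -[vtx _]scale1r; apply: path_span_vtx.
  move=> d; apply: homog_span_mulr => N v x xv; have xvv := mono_span_vtxr xv.
  have [ev|/eqP ev] := eqVneq (rng e) v.
    by rewrite -ev in xv; exact: homog_span_mono (mono_span_ghost xv).
  by rewrite (mul_ghost_neq xvv ev); apply: homog_span_0.
- split=> [|d y _]; first exact: homog_span_0.
  by rewrite lpa_mul0r; apply: homog_span_0.
- split=> [|d z zd]; first exact: homog_span_add.
  by rewrite lpa_mulDr; apply: homog_span_add; [apply: Hx|apply: Hy].
- split=> [|d z zd]; first exact: homog_span_scale.
  by rewrite -lpa_scaleAr; apply/homog_span_scale/Hx.
- split=> [|d z zd]; first exact: Hy.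
  by rewrite lpa_mulA addrA; apply/Hy/Hx.
Qed.

Lemma homog_in_span n x : homog n x -> homog_span n x.
Proof. by case/homog_in_span_mulr. Qed.

Lemma homog_mono_span d v x : homog d x -> x ** vtx v = x ->
  exists N, mono_span N d v x.
Proof.
move=> /homog_in_span xd <-; elim: xd => {x} [|N w x xw|x y _ [N xN] _ [M yM]].
- by exists 0%N; rewrite lpa_mul0l; apply: mono_span_0.
- exists N; have xww := mono_span_vtxr xw.
  have [<-|/eqP wv] := eqVneq w v; first by rewrite xww.
  by rewrite (mul_vtx_neq xww wv); apply: mono_span_0.
- exists (maxn N M); rewrite lpa_mulDl; apply: mono_span_add.
    by apply: mono_span_leq xN; rewrite leq_maxl.
  by apply: mono_span_leq yM; rewrite leq_maxr.
Qed.

(** [x] is a finite sum of elements [x v]. *)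
Lemma homog_vtx_neq0 d x : homog d x -> x <> 0 -> exists v, x ** vtx v <> 0.
Proof.
move=> /homog_in_span xd; have : locally_sum (fun v y => y ** vtx v) x.
  elim: xd => {x} [|N v x xv|x y _ IHx _ IHy].
  - by apply: locally_sum0 => v; rewrite lpa_mul0l.
  - have xvv := mono_span_vtxr xv; apply: (locally_sum1 (j := v)) => // w.
    by move=> /eqP/nesym; apply: mul_vtx_neq.
  - by apply: locally_sumD IHx IHy => v; rewrite lpa_mulDl.
move=> /locally_sum_eq0 sx x0; apply: contrapT => none; apply/x0/sx => v.
by apply: contrapT => xv; apply: none; exists v.
Qed.

(** The graded form of the reduction theorem for Leavitt path algebras. *)
Lemma homog_reduce d x : homog d x -> x <> 0 ->
  exists m n a b w, [/\ homog m a, homog n b & a ** x ** b = vtx w].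
Proof.
move=> xd x0; have [v xv] := homog_vtx_neq0 xd x0.
have xvd : homog (d + 0) (x ** vtx v) by apply/homog_mul/homog_vtx.
have [|N xN] := homog_mono_span (v := v) xvd; first by rewrite -lpa_mulA vtxM.
have [m [n [a [b [w [ma nb axb]]]]]] := mono_span_reduce xN xv.
exists m, (0 + n), a, (vtx v ** b), w; split=> //.
  exact/homog_mul/nb/homog_vtx.
by rewrite -axb !lpa_mulA.
Qed.

(** * Vertices generating minimal ideals *)
Definition simple_at w := forall d x,
  homog d x -> x ** vtx w = x -> x <> 0 -> exists a, a ** x = vtx w.

(** The sum in the Cuntz-Krieger relation has a single term. *)
Lemma edg_ghost e : ~ bifurcation (src e) -> edg e ** ghost e = vtx (src e).
Proof.
move=> nb; have out1 f : src f = src e -> f = e.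
  by move=> fe; apply: contrapT => ne; apply: nb; exists f, e.
have re : regular (src e).
  split; last by exists e.
  by apply: (sub_finite_set (B := [set e])) => // f /out1.
rewrite (lpa_ck K re) (bigD1_seq e) ?fset_uniq ?(mem_out_seq _ re) //=.
rewrite big_seq_cond big1 ?addr0 // => f /andP[].
by rewrite (mem_out_seq _ re) => /eqP/out1-> /eqP.
Qed.

(** By induction on the ghost part: if [a] sends [x e] to [rng e], then [e a]
    sends [x = x e e*] to [e e* = src e]. *)
Lemma unbranched_simple_at u : unbranched u -> simple_at u.
Proof.
move=> ub d x xd xu; have [N xN] := homog_mono_span xd xu.
elim: N u d x ub {xd xu} xN => [|N IH] u d x ub xu x0.
  by have [m [a [_ ax]]] := real_span_reduce (mono_span0_real xu) x0; exists a.
have [ru|[e eu xe]] := mono_span_edg_neq0 xu x0.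
  by have [m [a [_ ax]]] := real_span_reduce ru x0; exists a.
have xuu := mono_span_vtxr xu; have xeN := mono_span_edgr eu xu.
rewrite -eu in ub xuu *.
have ee : edg e ** ghost e = vtx (src e) by apply/edg_ghost/ub/tree_refl.
have [a axe] := IH _ _ _ (unbranched_edge ub) xeN xe.
exists (edg e ** a); rewrite -xuu -ee -!lpa_mulA.
by rewrite (lpa_mulA x) (lpa_mulA a) axe rng_ghost.
Qed.

(** [x] in [L (rng e)] is transported to [x e*] in [L (src e)], and back by right
    multiplication by [e]. *)
Lemma simple_at_edge e : simple_at (src e) -> simple_at (rng e).
Proof.
move=> sw d x xd xe x0; have xge : x ** ghost e ** edg e = x.
  by rewrite -lpa_mulA ghost_edg.
have [|||a ax] := sw (d - 1) (x ** ghost e).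
- exact/homog_mul/homog_ghost.
- by rewrite -lpa_mulA ghost_src.
- by move=> xg; apply: x0; rewrite -xge xg lpa_mul0l.
exists (ghost e ** a); rewrite -xge lpa_mulA -(lpa_mulA _ a) ax.
by rewrite ghost_src ghost_edg.
Qed.

(** If [e] and [f] are distinct edges leaving [w], then [w = a e*] for some [a],
    which is incompatible with [e* f = 0] and [w f = f]. *)
Lemma simple_at_not_bifurcation w : simple_at w -> ~ bifurcation w.
Proof.
move=> sw [e [f [ew fw ef]]]; rewrite -ew in sw fw.
have [a ae] := sw _ _ (homog_ghost K e) (ghost_src e) (@ghost_neq0 e).
apply: (@edg_neq0 f); rewrite -src_edg fw -ae -lpa_mulA ghost_edg_neq //.
exact: lpa_mul0r.
Qed.

Lemma simple_atP w : simple_at w <-> unbranched w.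
Proof.
split; last exact: unbranched_simple_at.
move=> sw x [p]; elim: p w sw => [|e p IH] w sw /=.
  by move=> <-; apply: simple_at_not_bifurcation.
by case=> ew; apply: IH; apply: simple_at_edge; rewrite ew.
Qed.

(** * Graded left ideals *)
Definition homog_sum (P : int -> L -> Prop) x := exists (d : seq int) (c : int -> L),
  (forall n, P n (c n)) /\ x = \sum_(n <- d) c n.

(** Terms of the same degree are collected, so that the components become a
    function of the degree. *)
Lemma homog_sumP (P : int -> L -> Prop) (l : seq (int * L)) :
    (forall n, P n 0) -> (forall n x y, P n x -> P n y -> P n (x + y)) ->
    (forall t, t \in l -> P t.1 t.2) ->
  homog_sum P (\sum_(t <- l) t.2).
Proof.
move=> P0 PD Pl; pose d := undup [seq t.1 | t <- l].
exists d, (fun n => \sum_(t <- l | t.1 == n) t.2); split.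
  move=> n; rewrite big_seq_cond; apply: big_ind => // [x y|t /andP[tl /eqP<-]].
    exact: PD.
  exact: Pl.
rewrite (exchange_big_dep xpredT) //= [LHS]big_seq [RHS]big_seq.
apply: eq_bigr => t tl; rewrite big_mkcond (bigD1_seq t.1) ?undup_uniq //=.
  by rewrite eqxx big1 ?addr0 // => n; rewrite eq_sym => /negPf->.
by rewrite mem_undup map_f.
Qed.

Lemma homog_components x : exists2 l : seq (int * L),
  (forall t, t \in l -> homog t.1 t.2) & x = \sum_(t <- l) t.2.
Proof.
have single n y : homog n y -> exists2 l : seq (int * L),
    (forall t, t \in l -> homog t.1 t.2) & y = \sum_(t <- l) t.2.
  move=> yn; exists [:: (n, y)]; last by rewrite big_seq1.
  by move=> t; rewrite inE => /eqP->.
elim/lpa_ind: x; elim=> [v|e|e||s [l Hl sl] t [m Hm tm]|s [l Hl sl]|k s [l Hl sl]|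
  s [l Hl sl] t [m Hm tm]].
- exact/single/homog_vtx.
- exact/single/homog_edg.
- exact/single/homog_ghost.
- exact/(single 0)/homog_0.
- exists (l ++ m); last by rewrite lpa_piD sl tm big_cat.
  by move=> p; rewrite mem_cat => /orP[/Hl|/Hm].
- exists [seq (p.1, - 1 *: p.2) | p <- l].
    by move=> _ /mapP[p /Hl pl ->]; apply: homog_scale.
  by rewrite lpa_piN sl big_map -scaler_sumr scaleN1r.
- exists [seq (p.1, k *: p.2) | p <- l].
    by move=> _ /mapP[p /Hl pl ->]; apply: homog_scale.
  by rewrite lpa_piZ sl big_map -scaler_sumr.
- exists [seq (p.1 + q.1, p.2 ** q.2) | p <- l, q <- m].
    by move=> _ /allpairsP[[p q] [/Hl pl /Hm qm ->]]; apply: homog_mul.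
  rewrite lpa_piM sl tm big_allpairs_dep /= lpa_mul_suml.
  by apply: eq_bigr => p _; rewrite lpa_mul_sumr.
Qed.

Lemma graded_left_principal d a : homog d a -> graded_left_ideal (left_principal a).
Proof.
move=> ad; split; first split.
- by exists 0 => //; rewrite lpa_mul0l.
- by move=> _ _ [x _ <-] [y _ <-]; exists (x - y) => //; rewrite lpa_mulBl.
- by move=> x _ [y _ <-]; exists (x ** y) => //; rewrite lpa_mulA.
move=> _ [x _ <-]; have [l Hl ->] := homog_components x.
rewrite lpa_mul_suml.
have := @homog_sumP (fun n y => left_principal a y /\ homog n y)
  [seq (t.1 + d, t.2 ** a) | t <- l].
rewrite big_map; apply=> [n|n _ _ [[y _ <-] yn] [[z _ <-] zn]|_ /mapP[t tl ->] /=].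
- by split; [exists 0 => //; rewrite lpa_mul0l|apply: homog_0].
- split; last exact: homog_add.
  by exists (y + z) => //; rewrite lpa_mulDl.
- by split; [exists t.2|apply: homog_mul => //; apply: Hl].
Qed.

Lemma graded_left_ideal_homog (S : set L) : graded_left_ideal S ->
  S <> [set 0] -> exists d x, [/\ homog d x, S x & x <> 0].
Proof.
move=> [[S0 _ _] gS] nS; apply: contrapT => none; apply: nS.
apply/seteqP; split=> [x /gS[d [c [Hc ->]]] /=|_ -> //].
rewrite big1 // => n _; have [Sc cn] := Hc n.
by apply: contrapT => c0; apply: none; exists n, (c n).
Qed.

Lemma left_principal_neq0 a x : x ** a <> 0 -> left_principal a <> [set 0].
Proof.
move=> xa0 a0; apply: xa0.
by have : left_principal a (x ** a) by [exists x]; rewrite a0.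
Qed.

Lemma left_principal_sub (S : set L) a :
  graded_left_ideal S -> S a -> left_principal a `<=` S.
Proof. by move=> [[_ _ SM] _] Sa _ [x _ <-]; apply: SM. Qed.

(** Any nonzero [L x] with [x] homogeneous in [S] is all of [S].  Applied to
    [a], this gives [S = L a]; applied to [y a] for a nonzero homogeneous [y] in
    [L w], it gives [a = t y a] for some [t], and multiplication by [b] on the
    right turns this into [w = t y]. *)
Lemma minimal_left_principal (S : set L) : minimal_graded_left_ideal S ->
  exists a b w d n, [/\ S = left_principal a, homog d a, homog n b &
    [/\ vtx w ** a = a, a ** b = vtx w & simple_at w]].
Proof.
move=> [gS nS minS]; have [[_ _ SM] _] := gS.
have principal d x y : homog d x -> S x -> y ** x <> 0 -> S = left_principal x.
  move=> xd Sx yx; have [] // := minS (left_principal x).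
  - exact: graded_left_principal xd.
  - exact: left_principal_sub.
  - by move/(left_principal_neq0 yx).
have [d [x [xd Sx x0]]] := graded_left_ideal_homog gS nS.
have [m [n [c [b0 [w [mc nb cxb]]]]]] := homog_reduce xd x0.
pose a := vtx w ** (c ** x); pose b := b0 ** vtx w.
have ab : a ** b = vtx w.
  by rewrite /a /b lpa_mulA -(lpa_mulA (vtx w)) cxb !vtxM.
have wa : vtx w ** a = a by rewrite /a lpa_mulA vtxM.
have ad : homog (0 + (m + d)) a.
  exact: (homog_mul (homog_vtx K w) (homog_mul mc xd)).
have Sa : S a by apply/SM/SM.
have Sprin : S = left_principal a.
  apply: (principal _ _ (vtx w) ad Sa); rewrite wa => a0.
  by apply: (@vtx_neq0 E K w); rewrite -ab a0 lpa_mul0l.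
have bn : homog (n + 0) b by apply/homog_mul/homog_vtx.
exists a, b, w, (0 + (m + d)), (n + 0); split=> //; split=> //.
clearbody a b.
move=> k y yk yw y0.
have [_ [_ [z [z' [v [_ _ zyz]]]]]] := homog_reduce yk y0.
(* [L (y a)] is nonzero: reducing [y = y a b] to a vertex shows that some left
   multiple of [y a] does not vanish. *)
have zy : z ** (y ** a) <> 0.
  move=> zya; apply: (@vtx_neq0 E K v).
  by rewrite -zyz -yw -ab !lpa_mulA -(lpa_mulA z) zya !lpa_mul0l.
have := Sa; rewrite (principal _ _ _ (homog_mul yk ad) (SM y a Sa) zy).
case=> t _ tya; exists t.
by rewrite -yw -ab -[in RHS]tya !lpa_mulA.
Qed.

(** Right multiplication by [b] is inverted by right multiplication by [a], since
    [a b = w] acts as the identity on [L w] and [b a] does so on [L a]. *)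
Lemma gm_iso_left_principal a b w n : homog n b ->
    vtx w ** a = a -> a ** b = vtx w ->
  gm_iso (ideal_module (left_principal a))
         (gm_shift (ideal_module (left_principal (vtx w))) n).
Proof.
move=> nb wa ab; exists (fun x => x ** b); split => /=.
- by move=> x y _ _; rewrite lpa_mulDl.
- by move=> x y _; rewrite lpa_mulA.
- split.
  + by move=> _ [x _ <-] /=; exists x => //; rewrite -lpa_mulA ab.
  + move=> x y; rewrite !inE => -[x' _ <-] [y' _ <-].
    rewrite -!lpa_mulA ab => /(congr1 (fun z => z ** a)).
    by rewrite -!lpa_mulA wa.
  + by move=> _ [x _ <-]; exists (x ** a); [exists x|rewrite -lpa_mulA ab].
- move=> k x [[y _ <-] xk]; split; last by rewrite addrC; apply: homog_mul.
  by exists y => //; rewrite -lpa_mulA ab.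
Qed.

(** Let [t] be a nonzero homogeneous element of a graded left ideal contained in
    [S].  Then [f t] is nonzero and homogeneous in [L u], so [c (f t) = u] for
    some [c].  For [y] in [S] this gives [f y = (f y) u = f ((f y) c t)], and
    [y = (f y) c t] because [f] is injective. *)
Lemma gm_iso_minimal (S : set L) u n : graded_left_ideal S -> simple_at u ->
    gm_iso (ideal_module S) (gm_shift (ideal_module (left_principal (vtx u))) n) ->
  minimal_graded_left_ideal S.
Proof.
move=> gS su [f [/= fD fM [fS finj fsurj] fdeg]].
have S0 : S 0 by case: gS => [[]].
have f0 : f 0 = 0 by apply: (addrI (f 0)); rewrite -fD ?addr0.
have fu x : S x -> f x ** vtx u = f x.
  by move=> /fS [y _ <-]; rewrite -lpa_mulA vtxM.
have inj x y : S x -> S y -> f x = f y -> x = y.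
  by move=> Sx Sy; apply: finj; rewrite inE.
split=> // [S00|T gT TS].
  have [|x Sx fx] := fsurj (vtx u); first by exists (vtx u); rewrite // vtxM.
  by apply: (@vtx_neq0 E K u); rewrite -fx; move: Sx; rewrite S00 => ->.
have [->|nT] := pselect (T = [set 0]); [by left|right].
have [d [t [td Tt t0]]] := graded_left_ideal_homog gT nT.
have St := TS _ Tt; have [[_ _ TM] _] := gT; have [[_ _ SM] _] := gS.
have [_ ftd] := fdeg d t (conj St td).
have [ft0|c cft] := su _ _ ftd (fu _ St).
  by apply: t0; apply: inj; rewrite ?f0.
apply/seteqP; split=> // y Sy; suff -> : y = f y ** c ** t by apply: TM.
apply: inj => //; first exact: SM.
by rewrite fM // -lpa_mulA cft fu.
Qed.

End Algebra.

(** * Minimal graded left ideals *)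

Theorem proposition2p9 (E : digraph) (K : fieldType) (S : set (lpa E K))
    (hS : graded_left_ideal S) :
  minimal_graded_left_ideal S <->
  exists a : lpa E K,
    [/\ exists d : int, homog d a,
        S = left_principal a &
        exists (u : vertex E) (n : int),
          (line_point u \/ laurent_vertex u) /\
          gm_iso (ideal_module (left_principal a))
                 (gm_shift (ideal_module (left_principal (vtx K u))) n)].
Proof.
split=> [minS|[a [_ Sa [u [n [lu iso]]]]]].
  have [a [b [w [d [n [Sa ad nb [wa ab sw]]]]]]] := minimal_left_principal minS.
  exists a; split=> //; first by exists d.
  exists w, n; split; first by apply/line_or_laurentP/simple_atP; exact: sw.
  exact: gm_iso_left_principal nb wa ab.
rewrite -Sa in iso; apply: gm_iso_minimal iso => //.
exact/simple_atP/line_or_laurentP.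
Qed.
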